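(* Let $f:\mathbb{R}\to\mathbb{R}$ be a function and let $x_0\in\mathbb{R}$. Define two sequences by $x_0^{+}=x_0^{-}=x_0$ and, for each $n\ge 0$, $$x^{+}_{n+1}=x^{+}_n+\frac{f(x^{+}_n)}{2},\qquad x^{-}_{n+1}=x^{-}_n-\frac{f(x^{-}_n)}{2}.$$ (1) Suppose $c$ is a root of $f$ with $x_0<c$, that $f$ has no root in $[x_0,c)$, and that $f$ is differentiable at each point of $[x_0,c]$ with $\lvert f'(x)\rvert\le 2$ for each $x\in[x_0,c]$. Then at least one of the sequences $\{x^{+}_n\}$, $\{x^{-}_n\}$ converges to $c$. (2) Suppose $c$ is a root of $f$ with $c<x_0$, that $f$ has no root in $(c,x_0]$, and that $f$ is differentiable at each point of $[c,x_0]$ with $\lvert f'(x)\rvert\le 2$ for each $x\in[c,x_0]$. Then at least one of the sequences $\{x^{+}_n\}$, $\{x^{-}_n\}$ converges to $c$.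
   Context: A root of $f$ is a point $x$ with $f(x)=0$. *)

(* Defs.v *)
From Stdlib Require Import Reals.
Open Scope R_scope.

Fixpoint x_plus (f : R -> R) (x0 : R) (n : nat) : R :=
  match n with
  | O => x0
  | S m => x_plus f x0 m + f (x_plus f x0 m) / 2
  end.

Fixpoint x_minus (f : R -> R) (x0 : R) (n : nat) : R :=
  match n with
  | O => x0
  | S m => x_minus f x0 m - f (x_minus f x0 m) / 2
  end.

Definition is_root (f : R -> R) (x : R) : Prop := f x = 0.

(* Main.v *)
(** Since f has no root strictly between x0 and c, it has constant sign there,
    and [|f x| <= 2 |c - x|] by the mean value theorem.  Hence one of the two
    iterations always moves towards c without overshooting; being monotone and
    bounded it converges, and by continuity its limit is a root, that is, c.
    The reflections [f |-> -f] and [f |-> (x |-> - f (- x))] reduce every case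
    to that of [x_plus] with f positive to the left of c. *)
Require Import Defs.
From Stdlib Require Import Reals Ranalysis5 Lra.
From Coquelicot Require Import Coquelicot.
Open Scope R_scope.

Lemma x_minus_opp (f : R -> R) (x0 : R) (n : nat) :
  x_minus f x0 n = x_plus (fun x => - f x) x0 n.
Proof. induction n as [|n IH]; simpl; [reflexivity | rewrite IH; lra]. Qed.

Lemma x_plus_reflect (f : R -> R) (x0 : R) (n : nat) :
  x_plus (fun x => - f (- x)) (- x0) n = - x_plus f x0 n.
Proof.
  induction n as [|n IH]; simpl; [reflexivity|].
  rewrite IH, Ropp_involutive; lra.
Qed.

Lemma x_minus_reflect (f : R -> R) (x0 : R) (n : nat) :
  x_minus (fun x => - f (- x)) (- x0) n = - x_minus f x0 n.
Proof. rewrite !x_minus_opp; apply (x_plus_reflect (fun x => - f x)). Qed.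

(** A value [f x <= 0] would be negative, as [x] is no root, and the intermediate value theorem
    would then give a root between [a] and [x]. *)
Lemma pos_of_no_root (f : R -> R) (a b : R) :
  (forall x, a <= x <= b -> continuity_pt f x) ->
  (forall x, a <= x < b -> f x <> 0) ->
  0 < f a -> forall x, a <= x < b -> 0 < f x.
Proof.
  intros Hc Hr Ha x Hx.
  destruct (Rlt_le_dec 0 (f x)) as [H|H]; [exact H|exfalso].
  assert (Hfx : f x < 0) by (specialize (Hr x Hx); lra).
  assert (Hax : a < x) by (destruct (Req_dec a x); [subst|]; lra).
  (* [IVT_interv] expects a change from negative to positive, hence the negation. *)
  destruct (IVT_interv (fun t => - f t) a x) as [z [Hz Hfz]]; try lra.
  - intros t Ht; apply continuity_pt_opp, Hc; lra.
  - apply (Hr z); lra.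
Qed.

(** The last hypothesis is the form in which the derivative bound enters: the step [f x / 2] never
    exceeds the remaining distance [c - x], and at [x = c] it forces [f c = 0]. *)
Lemma x_plus_cvg (f : R -> R) (x0 c : R) :
  x0 <= c ->
  (forall x, x0 <= x <= c -> continuity_pt f x) ->
  (forall x, x0 <= x < c -> 0 < f x) ->
  (forall x, x0 <= x <= c -> Rabs (f x) <= 2 * (c - x)) ->
  is_lim_seq (x_plus f x0) c.
Proof.
  intros H0 Hc Hpos Hle.
  assert (Hfc : f c = 0).
  { specialize (Hle c (conj H0 (Rle_refl c))).
    apply Rabs_eq_0; pose proof (Rabs_pos (f c)); lra. }
  assert (Hnn : forall x, x0 <= x <= c -> 0 <= f x).
  { intros x Hx; destruct (Req_dec x c) as [->|]; [lra|].
    apply Rlt_le, Hpos; lra. }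
  assert (Hin : forall n, x0 <= x_plus f x0 n <= c).
  { induction n as [|n IH]; simpl; [lra|].
    specialize (Hnn _ IH); specialize (Hle _ IH).
    pose proof (Rle_abs (f (x_plus f x0 n))); lra. }
  destruct (ex_finite_lim_seq_incr (x_plus f x0) c) as [l Hl].
  { intros n; simpl; specialize (Hnn _ (Hin n)); lra. }
  { intros n; apply Hin. }
  assert (Hlin : x0 <= l <= c).
  { split.
    - apply (is_lim_seq_le (fun _ => x0) (x_plus f x0) x0 l);
        [intros n; apply Hin | apply is_lim_seq_const | exact Hl].
    - apply (is_lim_seq_le (x_plus f x0) (fun _ => c) l c);
        [intros n; apply Hin | exact Hl | apply is_lim_seq_const]. }
  (* Twice the increment is exactly [f (x_plus f x0 n)], so these values tend to 0; by continuity
     they also tend to [f l]. *)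
  assert (Hstep : is_lim_seq (fun n => 2 * (x_plus f x0 (S n) - x_plus f x0 n))
                    (2 * (l - l))).
  { apply (is_lim_seq_scal_l _ 2 (l - l)), is_lim_seq_minus'; [|exact Hl].
    apply (is_lim_seq_incr_1 (x_plus f x0)), Hl. }
  assert (Hfl : is_lim_seq (fun n => f (x_plus f x0 n)) (f l)).
  { apply is_lim_seq_continuous; [apply Hc, Hlin | exact Hl]. }
  assert (Hroot : f l = 0).
  { apply (is_lim_seq_ext _ (fun n => f (x_plus f x0 n))) in Hstep;
      [|intros n; simpl; field].
    apply is_lim_seq_unique in Hstep; apply is_lim_seq_unique in Hfl.
    rewrite Hfl in Hstep; injection Hstep; lra. }
  destruct (Req_dec l c) as [<-|]; [exact Hl|].
  specialize (Hpos l); lra.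
Qed.

Lemma x_plus_or_x_minus_cvg (f : R -> R) (x0 c : R) :
  is_root f c -> x0 < c ->
  (forall x, x0 <= x < c -> ~ is_root f x) ->
  (forall x, x0 <= x <= c -> ex_derive f x /\ Rabs (Derive f x) <= 2) ->
  is_lim_seq (x_plus f x0) c \/ is_lim_seq (x_minus f x0) c.
Proof.
  unfold is_root; intros Hfc H0 Hr Hd.
  assert (Hc : forall x, x0 <= x <= c -> continuity_pt f x).
  { intros x Hx; apply continuity_pt_filterlim.
    exact (ex_derive_continuous f x (proj1 (Hd x Hx))). }
  assert (Hle : forall x, x0 <= x <= c -> Rabs (f x) <= 2 * (c - x)).
  { intros x Hx.
    (* Since [f c = 0], the mean value theorem gives [f x = - f'(z) (c - x)]. *)
    destruct (MVT_gen f x c (Derive f)) as [z [Hz Heq]];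
      rewrite ?Rmin_left, ?Rmax_right in * by lra.
    - intros t Ht; apply Derive_correct, Hd; lra.
    - intros t Ht; apply Hc; lra.
    - replace (f x) with (- (Derive f z * (c - x))) by lra.
      rewrite Rabs_Ropp, Rabs_mult, (Rabs_pos_eq (c - x)) by lra.
      apply Rmult_le_compat_r; [lra | apply Hd; lra]. }
  destruct (Rtotal_order (f x0) 0) as [Hneg|[Hz|Hpos]].
  - right.
    apply (is_lim_seq_ext (x_plus (fun x => - f x) x0));
      [intros n; symmetry; apply x_minus_opp|].
    assert (Hc' : forall x, x0 <= x <= c -> continuity_pt (fun t => - f t) x)
      by (intros x Hx; apply continuity_pt_opp, Hc, Hx).
    apply x_plus_cvg; [lra | exact Hc' | |].
    + apply (pos_of_no_root _ x0 c Hc'); [|lra].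
      intros x Hx; specialize (Hr x Hx); lra.
    + intros x Hx; rewrite Rabs_Ropp; apply Hle, Hx.
  - exfalso; apply (Hr x0); lra.
  - left; apply x_plus_cvg; [lra | exact Hc | | exact Hle].
    exact (pos_of_no_root f x0 c Hc Hr Hpos).
Qed.

Lemma is_lim_seq_of_opp (u v : nat -> R) (l : R) :
  (forall n, u n = - v n) -> is_lim_seq u (- l) -> is_lim_seq v l.
Proof.
  intros Huv Hu; apply is_lim_seq_opp; simpl.
  exact (is_lim_seq_ext _ _ _ Huv Hu).
Qed.

Theorem corollary2p3 (f : R -> R) (x0 : R) :
  (forall c : R,
     is_root f c -> x0 < c ->
     (forall x : R, x0 <= x < c -> ~ is_root f x) ->
     (forall x : R, x0 <= x <= c -> ex_derive f x /\ Rabs (Derive f x) <= 2) ->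
     is_lim_seq (x_plus f x0) (Finite c) \/ is_lim_seq (x_minus f x0) (Finite c))
  /\
  (forall c : R,
     is_root f c -> c < x0 ->
     (forall x : R, c < x <= x0 -> ~ is_root f x) ->
     (forall x : R, c <= x <= x0 -> ex_derive f x /\ Rabs (Derive f x) <= 2) ->
     is_lim_seq (x_plus f x0) (Finite c) \/ is_lim_seq (x_minus f x0) (Finite c)).
Proof.
  split; intros c Hfc H0 Hr Hd.
  { exact (x_plus_or_x_minus_cvg f x0 c Hfc H0 Hr Hd). }
  unfold is_root in Hfc, Hr.
  (* The reflection through the origin carries [[c, x0]] to [[-x0, -c]], so the root now lies to the
     right of the start. *)
  destruct (x_plus_or_x_minus_cvg (fun x => - f (- x)) (- x0) (- c)) as [H|H].
  - unfold is_root; rewrite Ropp_involutive; lra.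
  - lra.
  - unfold is_root; intros x Hx Hfx; apply (Hr (- x)); lra.
  - intros x Hx; destruct (Hd (- x)) as [Hex Hb]; [lra|].
    (* The two signs cancel in the chain rule, so the bound 2 carries over. *)
    assert (His : is_derive (fun t => - f (- t)) x (Derive f (- x))).
    { auto_derive; [exact Hex|].
      rewrite (Derive_ext _ f) by reflexivity; ring. }
    split; [exact (ex_intro _ _ His)|].
    apply is_derive_unique in His; simpl in *; rewrite His; exact Hb.
  - left; exact (is_lim_seq_of_opp _ _ _ (x_plus_reflect f x0) H).
  - right; exact (is_lim_seq_of_opp _ _ _ (x_minus_reflect f x0) H).
Qed.
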